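(* Let $G$ be an infinite finitely generated group with commutator subgroup $G'$. If $G$ is not perfect (i.e. $G\neq G'$), then the Lie algebra $\mathrm{Der}$ of derivations of the group algebra $\mathbb{C}[G]$ admits a (non-trivial) grading with $G/G'$.
   Context: A derivation is a $\mathbb{C}$-linear operator $d:\mathbb{C}[G]\to\mathbb{C}[G]$ with $d(ab)=d(a)b+a\,d(b)$ for all $a,b$; $\mathrm{Der}$ is the Lie algebra of all derivations with bracket $[d,\partial](x)=d(\partial(x))-\partial(d(x))$. $G'$ is the subgroup generated by all commutators $xyx^{-1}y^{-1}$, $x,y\in G$. Definition: for an abelian group $A$ (written multiplicatively, neutral element $e$), a Lie algebra $\mathfrak{A}$ is graded with $A$ if $\mathfrak{A}=\bigoplus_{n\in A}\mathfrak{A}_n$ (direct sum of subspaces) with $[\mathfrak{A}_n,\mathfrak{A}_l]\subset\mathfrak{A}_{nl}$ for all $n,l\in A$ and $\mathfrak{A}_e\neq\mathfrak{A}$ (trivial gradings are excluded). *)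

(* Defs.v *)
(* Possibly infinite groups are MathComp's [groupType]; complex numbers are
   [R[i]] for [R : realType]. *)
From HB Require Import structures.
From mathcomp Require Import all_boot all_order all_algebra finmap.
From mathcomp Require Import boolp classical_sets functions cardinality reals.
From mathcomp Require Import complex.
From mathcomp Require Import monalg.

Set Implicit Arguments.
Unset Strict Implicit.
Unset Printing Implicit Defensive.

Import GRing.Theory.

Local Open Scope classical_set_scope.
Local Open Scope ring_scope.

Section Groups.
Context {G : groupType}.
Implicit Types (x y z : G) (S : set G).
Local Open Scope group_scope.

Definition subgroup_generated S : set G :=
  smallest [set H : set G | group_closed [in H]] S.

Definition finitely_generated : Prop :=
  exists2 S : set G, finite_set S & subgroup_generated S = [set: G].

Definition commutators : set G :=
  [set c | exists x y, c = x * y * x^-1 * y^-1].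

Definition commutator_subgroup : set G := subgroup_generated commutators.

Lemma subgroup_generated_incl S : S `<=` subgroup_generated S.
Proof. exact: sub_smallest. Qed.

Lemma subgroup_generated_min S (H : set G) :
  group_closed [in H] -> S `<=` H -> subgroup_generated S `<=` H.
Proof. by move=> gH SH; apply: smallest_sub. Qed.

Lemma subgroup_generated_closed S : group_closed [in subgroup_generated S].
Proof.
split=> [|x y]; rewrite !inE.
  by move=> H [[H1 _] _]; move: H1; rewrite inE.
move=> Sx Sy H [gH SH]; have [_ Hdiv] := gH.
have := Hdiv x y; rewrite !inE; apply.
  exact: (subgroup_generated_min gH SH Sx).
exact: (subgroup_generated_min gH SH Sy).
Qed.

Lemma commutator_subgroup1 : commutator_subgroup 1.
Proof. by have [] := subgroup_generated_closed commutators; rewrite inE. Qed.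

Lemma commutator_subgroupV x :
  commutator_subgroup x -> commutator_subgroup x^-1.
Proof.
have := group_closedV (subgroup_generated_closed commutators).
by move=> /(_ x); rewrite !inE.
Qed.

Lemma commutator_subgroupM x y :
  commutator_subgroup x -> commutator_subgroup y -> commutator_subgroup (x * y).
Proof.
have := group_closedM (subgroup_generated_closed commutators).
by move=> /(_ x y); rewrite !inE.
Qed.

Lemma commutator_subgroupR x y : commutator_subgroup (x * y * x^-1 * y^-1).
Proof. by apply: subgroup_generated_incl; exists x, y. Qed.

Lemma commutator_subgroupJ x y :
  commutator_subgroup x -> commutator_subgroup (y * x * y^-1).
Proof.
move=> Gx; have := commutator_subgroupM (commutator_subgroupR y x) Gx.
by rewrite -!mulgA mulVg mulg1.
Qed.

Definition eq_mod_commutator : rel G :=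
  fun x y => `[< commutator_subgroup (x^-1 * y) >].

Lemma eq_mod_commutator_refl : reflexive eq_mod_commutator.
Proof. by move=> x; apply/asboolP; rewrite mulVg; exact: commutator_subgroup1. Qed.

Lemma eq_mod_commutator_sym : symmetric eq_mod_commutator.
Proof.
by move=> x y; apply/asboolP/asboolP => /commutator_subgroupV;
  rewrite invgM invgK.
Qed.

Lemma eq_mod_commutator_trans : transitive eq_mod_commutator.
Proof.
move=> y x z /asboolP xy /asboolP yz; apply/asboolP.
by have := commutator_subgroupM xy yz; rewrite mulgA mulgK.
Qed.

Canonical eq_mod_commutator_equiv := EquivRel eq_mod_commutator
  eq_mod_commutator_refl eq_mod_commutator_sym eq_mod_commutator_trans.

End Groups.

Arguments finitely_generated : clear implicits.
Arguments commutator_subgroup : clear implicits.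

Definition abelianization (G : groupType) : Type :=
  {eq_quot (@eq_mod_commutator G)}%qT.

Section Abelianization.
Context {G : groupType}.
Implicit Types (x y : G) (a b c : abelianization G).
Local Open Scope group_scope.
Local Open Scope quotient_scope.
Local Notation proj := (\pi_(abelianization G)).

HB.instance Definition _ := Choice.on (abelianization G).
HB.instance Definition _ := EqQuotient.on (abelianization G).

Definition ab_one : abelianization G := proj 1.
Definition ab_inv a : abelianization G := proj (repr a)^-1.
Definition ab_mul a b : abelianization G := proj (repr a * repr b).

Lemma ab_eqP x y :
  x = y %[mod abelianization G] <-> commutator_subgroup G (x^-1 * y).
Proof.
split=> [/eqP|h]; last by apply/eqP; rewrite eqmodE; apply/asboolP.
by rewrite eqmodE => /asboolP.
Qed.

Lemma ab_repr_pi x : exists2 u, commutator_subgroup G u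
  & repr (proj x) = x * u.
Proof.
exists (x^-1 * repr (proj x)); last by rewrite mulVKg.
by apply/ab_eqP; rewrite reprK.
Qed.

Lemma ab_mul_pi x y : ab_mul (proj x) (proj y) = proj (x * y).
Proof.
have [u Gu eu] := ab_repr_pi x; have [v Gv ev] := ab_repr_pi y.
rewrite /ab_mul eu ev; apply/esym/ab_eqP.
rewrite invgM -mulgA (mulgA x^-1) -!mulgA mulKg !mulgA.
apply: commutator_subgroupM => //.
by have := commutator_subgroupJ y^-1 Gu; rewrite invgK.
Qed.

Lemma ab_inv_pi x : ab_inv (proj x) = proj x^-1.
Proof.
have [u Gu eu] := ab_repr_pi x; rewrite /ab_inv eu; apply/ab_eqP.
by rewrite invgK; exact: commutator_subgroupJ.
Qed.

Lemma ab_ind (P : abelianization G -> Prop) :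
  (forall x, P (proj x)) -> forall a, P a.
Proof. by move=> Ppi a; rewrite -[a]reprK. Qed.

Lemma ab_mulA : associative ab_mul.
Proof.
by elim/ab_ind=> x; elim/ab_ind=> y; elim/ab_ind=> z; rewrite !ab_mul_pi mulgA.
Qed.

Lemma ab_mul1g : left_id ab_one ab_mul.
Proof. by elim/ab_ind=> x; rewrite ab_mul_pi mul1g. Qed.

Lemma ab_mulg1 : right_id ab_one ab_mul.
Proof. by elim/ab_ind=> x; rewrite ab_mul_pi mulg1. Qed.

Lemma ab_mulVg : left_inverse ab_one ab_inv ab_mul.
Proof. by elim/ab_ind=> x; rewrite ab_inv_pi ab_mul_pi mulVg. Qed.

Lemma ab_mulgV : right_inverse ab_one ab_inv ab_mul.
Proof. by elim/ab_ind=> x; rewrite ab_inv_pi ab_mul_pi mulgV. Qed.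

HB.instance Definition _ := isGroup.Build (abelianization G)
  ab_mulA ab_mul1g ab_mulg1 ab_mulVg ab_mulgV.

Lemma ab_piM x y : proj (x * y) = proj x * proj y.
Proof. by rewrite -ab_mul_pi. Qed.

Lemma abelianizationC a b : a * b = b * a.
Proof.
elim/ab_ind: a => x; elim/ab_ind: b => y; rewrite -!ab_piM; apply/ab_eqP.
have := commutator_subgroupR y^-1 x^-1.
by rewrite !invgK invgM !mulgA.
Qed.

End Abelianization.

(* [{malg K[G]}] only receives a ring structure from multinomials when the only
   invertible element of the monoid of exponents is 1, which excludes
   nontrivial groups; hence the alias and the convolution product below. *)
Definition group_algebra (K : comNzRingType) (G : groupType) : Type :=
  {malg K[G]}.

Section GroupAlgebra.
Context {K : comNzRingType} {G : groupType}.
Implicit Types (a b c : group_algebra K G).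

HB.instance Definition _ := GRing.Lmodule.copy (group_algebra K G) {malg K[G]}.

Definition ga_one : group_algebra K G := << 1 *g 1%g >>.

Definition ga_mul a b : group_algebra K G :=
  \sum_(x <- msupp a) \sum_(y <- msupp b) << a@_x * b@_y *g (x * y)%g >>.

Let ga_mulw (d1 d2 : {fset G}) a b :
  (msupp a `<=` d1)%fset -> (msupp b `<=` d2)%fset ->
  ga_mul a b =
  \sum_(x <- d1) \sum_(y <- d2) << a@_x * b@_y *g (x * y)%g >>.
Proof.
move=> le1 le2; rewrite /ga_mul (big_fset_incl _ le1) /=.
  apply: eq_bigr => x _; apply: big_fset_incl => // y _ /mcoeff_outdom ->.
  by rewrite mulr0 monalgU0.
move=> x _ /mcoeff_outdom ax.
by rewrite big1 // => y _; rewrite ax mul0r monalgU0.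
Qed.

Lemma ga_mulDl : left_distributive ga_mul +%R.
Proof.
move=> a b c; pose d := (msupp a `|` msupp b)%fset.
have ld := fsubset_refl (msupp c).
rewrite (ga_mulw (msuppD_le a b) ld) (ga_mulw (fsubsetUl _ (msupp b)) ld).
rewrite (ga_mulw (fsubsetUr (msupp a) _) ld) -big_split; apply: eq_bigr => x _.
by rewrite -big_split; apply: eq_bigr => y _; rewrite mcoeffD mulrDl monalgUD.
Qed.

Lemma ga_mulDr : right_distributive ga_mul +%R.
Proof.
move=> c a b; have ld := fsubset_refl (msupp c).
rewrite (ga_mulw ld (msuppD_le a b)) (ga_mulw ld (fsubsetUl _ (msupp b))).
rewrite (ga_mulw ld (fsubsetUr (msupp a) _)) -big_split; apply: eq_bigr => x _.
by rewrite -big_split; apply: eq_bigr => y _; rewrite mcoeffD mulrDr monalgUD.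
Qed.

Let ga_mul0l a : ga_mul 0 a = 0.
Proof. by rewrite /ga_mul msupp0 big_seq_fset0. Qed.

Let ga_mul0r a : ga_mul a 0 = 0.
Proof.
by rewrite /ga_mul big1 // => x _; rewrite msupp0 big_seq_fset0.
Qed.

Lemma ga_mulUU k l x y :
  ga_mul << k *g x >> << l *g y >> = << k * l *g (x * y)%g >>.
Proof. by rewrite (ga_mulw msuppU_le msuppU_le) !big_seq_fset1 !mcoeffUU. Qed.

Let ga_suml I (r : seq I) (F : I -> group_algebra K G) b :
  ga_mul (\sum_(i <- r) F i) b = \sum_(i <- r) ga_mul (F i) b.
Proof.
exact: (big_morph (ga_mul^~ b) (fun _ _ => ga_mulDl _ _ _) (ga_mul0l b)).
Qed.

Let ga_sumr I (r : seq I) (F : I -> group_algebra K G) a :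
  ga_mul a (\sum_(i <- r) F i) = \sum_(i <- r) ga_mul a (F i).
Proof.
exact: (big_morph (ga_mul a) (fun _ _ => ga_mulDr _ _ _) (ga_mul0r a)).
Qed.

Lemma ga_ind (P : group_algebra K G -> Prop) :
  P 0 -> (forall a b, P a -> P b -> P (a + b)) ->
  (forall k x, P << k *g x >>) -> forall a, P a.
Proof. by move=> P0 PD PU a; rewrite [a]monalgE; elim/big_ind: _. Qed.

Lemma ga_mulA : associative ga_mul.
Proof.
elim/ga_ind=> [b c|a a' IHa IHa' b c|k x]; first by rewrite !ga_mul0l.
  by rewrite !ga_mulDl IHa IHa'.
elim/ga_ind=> [c|b b' IHb IHb' c|l y]; first by rewrite ga_mul0r !ga_mul0l ga_mul0r.
  by rewrite ga_mulDr !ga_mulDl ga_mulDr IHb IHb'.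
elim/ga_ind=> [|c c' IHc IHc'|m z]; first by rewrite !ga_mul0r.
  by rewrite !ga_mulDr IHc IHc'.
by rewrite !ga_mulUU mulrA mulgA.
Qed.

Lemma ga_mul1l : left_id ga_one ga_mul.
Proof.
elim/ga_ind=> [|a b IHa IHb|k x]; first by rewrite ga_mul0r.
  by rewrite ga_mulDr IHa IHb.
by rewrite ga_mulUU mul1r mul1g.
Qed.

Lemma ga_mul1r : right_id ga_one ga_mul.
Proof.
elim/ga_ind=> [|a b IHa IHb|k x]; first by rewrite ga_mul0l.
  by rewrite ga_mulDl IHa IHb.
by rewrite ga_mulUU mulr1 mulg1.
Qed.

Lemma ga_one_neq0 : ga_one != 0.
Proof. by rewrite monalgU_eq0 oner_eq0. Qed.

HB.instance Definition _ := GRing.Zmodule_isNzRing.Build (group_algebra K G)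
  ga_mulA ga_mul1l ga_mul1r ga_mulDl ga_mulDr ga_one_neq0.

Let ga_scaleU (k l : K) x : k *: (<< l *g x >> : group_algebra K G) = << k * l *g x >>.
Proof. by apply/malgP => y; rewrite mcoeffZ !mcoeffU mulrnAr. Qed.

Lemma ga_scaleAl (k : K) a b : k *: (a * b) = k *: a * b.
Proof.
elim/ga_ind: a b => [b|a a' IHa IHa' b|l x]; first by rewrite mul0r scaler0 mul0r.
  by rewrite mulrDl !scalerDr mulrDl IHa IHa'.
elim/ga_ind=> [|b b' IHb IHb'|m y]; first by rewrite !mulr0 scaler0.
  by rewrite !mulrDr scalerDr IHb IHb'.
by rewrite ga_scaleU -[RHS]/(ga_mul _ _) -[X in k *: X]/(ga_mul _ _) !ga_mulUU
  ga_scaleU mulrA.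
Qed.

Lemma ga_scaleAr (k : K) a b : k *: (a * b) = a * (k *: b).
Proof.
elim/ga_ind: a b => [b|a a' IHa IHa' b|l x]; first by rewrite !mul0r scaler0.
  by rewrite mulrDl !scalerDr mulrDl IHa IHa'.
elim/ga_ind=> [|b b' IHb IHb'|m y]; first by rewrite mulr0 !scaler0 mulr0.
  by rewrite mulrDr !scalerDr mulrDr IHb IHb'.
by rewrite ga_scaleU -[RHS]/(ga_mul _ _) -[X in k *: X]/(ga_mul _ _) !ga_mulUU
  ga_scaleU mulrCA.
Qed.

HB.instance Definition _ :=
  GRing.Lmodule_isLalgebra.Build K (group_algebra K G) ga_scaleAl.
HB.instance Definition _ :=
  GRing.Lalgebra_isAlgebra.Build K (group_algebra K G) ga_scaleAr.

End GroupAlgebra.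

HB.mixin Record Lmodule_isLieAlgebra (K : comNzRingType) L
    of GRing.Lmodule K L := {
  lie : L -> L -> L;
  lie_linearl : forall y, linear (lie^~ y);
  lie_linearr : forall x, linear (lie x);
  liexx : forall x, lie x x = 0;
  lie_jacobi : forall x y z,
    lie x (lie y z) + lie y (lie z x) + lie z (lie x y) = 0
}.

#[short(type="lieAlgType")]
HB.structure Definition LieAlgebra (K : comNzRingType) :=
  {L of Lmodule_isLieAlgebra K L & GRing.Lmodule K L}.

Section Derivations.
Context {K : comNzRingType} {A : algType K}.
Implicit Types (d e f : A -> A) (a b : A).

Definition derivation : {pred A -> A} :=
  fun d => `[< linear d /\ forall a b, d (a * b) = d a * b + a * d b >].

Lemma derivation_submod_closed : GRing.submod_closed derivation.
Proof.
split=> [|k d e /asboolP[dZ dM] /asboolP[eZ eM]]; apply/asboolP.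
  split=> [k a b|a b]; rewrite -![(0 : A -> A) _]/(0 : A).
    by rewrite scaler0 addr0.
  by rewrite mul0r mulr0 addr0.
split=> [l a b|a b]; rewrite -![(k *: d + e) _]/(k *: d _ + e _).
  rewrite dZ eZ !scalerDr !scalerA (mulrC k l) -!addrA; congr (_ + _).
  by rewrite addrCA.
rewrite dM eM scalerDr mulrDl mulrDr scalerAl scalerAr -!addrA.
by congr (_ + _); rewrite addrCA.
Qed.

HB.instance Definition _ :=
  GRing.isSubmodClosed.Build K (A -> A) derivation derivation_submod_closed.

Record Der : Type := MkDer { Der_val :> A -> A; _ : Der_val \in derivation }.

HB.instance Definition _ := [isSub for Der_val].
HB.instance Definition _ := [Choice of Der by <:].
HB.instance Definition _ := [SubChoice_isSubLmodule of Der by <:].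

Implicit Types (D E F : Der).

Lemma Der_linear D : linear D.
Proof. by have /asboolP[] := valP D. Qed.

Lemma Der_leibniz D a b : D (a * b) = D a * b + a * D b.
Proof. by have /asboolP[] := valP D. Qed.

HB.instance Definition _ D := GRing.isLinear.Build K A A _ D (@Der_linear D).

Lemma DerP D E : D =1 E -> D = E.
Proof. by move=> DE; apply: val_inj; apply: funext. Qed.

Fact commutator_derivation D E :
  (fun a => D (E a) - E (D a)) \in derivation.
Proof.
apply/asboolP; split=> [k a b|a b].
  by rewrite !Der_linear scalerBr opprD addrACA.
have DD F u v : F (u + v) = F u + F v := raddfD F u v.
rewrite !Der_leibniz !DD !Der_leibniz mulrBl mulrBr !opprD !addrA.
by rewrite [LHS](ACl ((1*5*4*8)*(2*7)*(3*6))%AC) /= !subrr !addr0.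
Qed.

Definition Der_lie D E : Der := MkDer (commutator_derivation D E).

Let Der_valD D E a : (D + E) a = D a + E a. Proof. by []. Qed.
Let Der_valZ k D a : (k *: D) a = k *: D a. Proof. by []. Qed.
Let Der_lieE D E a : Der_lie D E a = D (E a) - E (D a). Proof. by []. Qed.

Fact Der_lie_linearl E : linear (Der_lie^~ E).
Proof.
move=> k D F; apply: DerP => a; rewrite !(Der_valD, Der_valZ, Der_lieE).
by rewrite Der_linear scalerBr opprD addrACA.
Qed.

Fact Der_lie_linearr D : linear (Der_lie D).
Proof.
move=> k E F; apply: DerP => a; rewrite !(Der_valD, Der_valZ, Der_lieE).
by rewrite Der_linear scalerBr opprD addrACA.
Qed.

Fact Der_liexx D : Der_lie D D = 0.
Proof. by apply: DerP => a; rewrite Der_lieE subrr. Qed.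

Fact Der_lie_jacobi D E F :
  Der_lie D (Der_lie E F) + Der_lie E (Der_lie F D)
    + Der_lie F (Der_lie D E) = 0.
Proof.
have DB (H : Der) u v : H (u - v) = H u - H v := raddfB H u v.
apply: DerP => a; rewrite !(Der_valD, Der_lieE) !DB !opprB !addrA.
rewrite [LHS](ACl ((1*12)*(7*2)*(3*10)*(5*4)*(11*6)*(9*8))%AC) /=.
by rewrite !subrr !addr0.
Qed.

HB.instance Definition _ := Lmodule_isLieAlgebra.Build K Der
  Der_lie_linearl Der_lie_linearr Der_liexx Der_lie_jacobi.

End Derivations.

Arguments Der {K} A.

Section Gradings.
Context {K : comNzRingType}.

(* The second clause says that L is the direct sum of the D n: the canonical map
   from the finitely supported families (f n)_n with f n in D n to L is
   bijective. *)
Definition is_grading (A : groupType) (L : lieAlgType K) (D : A -> {pred L}) :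
    Prop :=
  [/\ forall n, GRing.submod_closed (D n),
      forall x, exists! f : {fsfun A -> L with 0},
        (forall n, f n \in D n) /\ x = \sum_(n <- finsupp f) f n,
      forall n l x y, x \in D n -> y \in D l -> lie x y \in D (n * l)%g
    & ~ (D 1%g =i predT)].

Definition graded_with (A : groupType) (L : lieAlgType K) : Prop :=
  (forall m n : A, (m * n = n * m)%g) /\ exists D : A -> {pred L}, is_grading D.

End Gradings.

(* Main.v *)
Require Import Defs.
From HB Require Import structures.
From mathcomp Require Import all_boot all_order all_algebra finmap.
From mathcomp Require Import boolp classical_sets functions cardinality reals.
From mathcomp Require Import complex.
From mathcomp Require Import monalg.

Set Implicit Arguments.
Unset Strict Implicit.
Unset Printing Implicit Defensive.

Local Open Scope classical_set_scope.
Local Open Scope ring_scope.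

Import Order.TTheory GRing.Theory Num.Theory.

(** Let phi : G -> A be a morphism to an abelian group.  Give x in G the degree
    phi x; this grades the group algebra, and a derivation D is homogeneous of
    degree n when D x is homogeneous of degree n * phi x for every x in G.  The
    part of D of degree n sends x to the part of D x of degree n * phi x.
    Because A is abelian this assignment obeys the Leibniz rule on G (left and
    right multiplication by x both shift degrees by phi x), so it extends to a
    derivation [component n D].

    The operators [component n] are orthogonal projections.  Finite generation
    makes every D the sum of finitely many of its components: each D s, for s a
    generator, involves finitely many degrees, and a derivation that kills the
    generators is zero ([Der_eq0_gen], [component_sum]).  Orthogonal projections
    that resolve every vector split the space into a direct sum
    ([projections_direct_sum]), and degrees add under composition, hence under
    the bracket ([graded_part_lie]).

    It remains to find a nonzero derivation of degree different from 1, for phi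
    nontrivial.  If phi g <> 1 and g does not commute with some h, the inner
    derivation by g has degree phi g and does not kill h.  Otherwise every
    element outside the kernel of phi is central; as these elements generate G,
    the group G is abelian.  An infinite finitely generated abelian group has a
    nonzero character chi : G -> Z ([abelian_character]), and then
    x |-> chi x * (x g) is a nonzero derivation of degree phi g.  The theorem is
    the case where phi is the projection of G onto its abelianization. *)

(** * Integer-valued characters of finitely generated abelian groups *)

Section IntegerSpan.
Context {V : zmodType}.
Implicit Types (r : seq V) (u v s : V).

Fixpoint int_span r v : Prop :=
  if r is s :: r' then exists a : int, int_span r' (v - s *~ a) else v = 0.

Lemma int_spanB r u v : int_span r u -> int_span r v -> int_span r (u - v).
Proof.
elim: r u v => [|s r IHr] u v /=; first by move=> -> ->; rewrite subrr.
move=> [a ua] [b vb]; exists (a - b).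
suff -> : u - v - s *~ (a - b) = u - s *~ a - (v - s *~ b) by exact: IHr.
by rewrite mulrzBr !opprB addrACA [RHS]addrACA (addrC (- v)).
Qed.

Lemma int_span0 r : int_span r 0.
Proof. by elim: r => //= s r IHr; exists 0; rewrite mulr0z subr0. Qed.

Lemma int_spanN r v : int_span r v -> int_span r (- v).
Proof. by rewrite -sub0r; apply: int_spanB; exact: int_span0. Qed.

Lemma int_spanD r u v : int_span r u -> int_span r v -> int_span r (u + v).
Proof. by move=> ru /int_spanN; rewrite -[v in u + v]opprK; exact: int_spanB. Qed.

Lemma int_spanMn r v n : int_span r v -> int_span r (v *+ n).
Proof.
move=> rv; elim: n => [|n IHn]; first exact: int_span0.
by rewrite mulrS; exact: int_spanD.
Qed.

Lemma int_span_mem r v : v \in r -> int_span r v.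
Proof.
elim: r => //= s r IHr; rewrite inE => /predU1P[->|/IHr rv]; last first.
  by exists 0; rewrite mulr0z subr0.
by exists 1; rewrite mulr1z subrr; exact: int_span0.
Qed.

(** Modulo m, each coefficient of an integer combination takes m values. *)
Lemma int_span_torsion_finite r (m : nat) :
  (0 < m)%N -> (forall v, v *+ m = 0) -> finite_set [set v | int_span r v].
Proof.
move=> m_gt0 mV; elim: r => [|s r IHr] /=; first exact: finite_set1.
apply: (@sub_finite_set _ _
  [set s *+ k + v | k in `I_m & v in [set v | int_span r v]]); last first.
  exact: finite_image2 (finite_II m) IHr.
move=> v /= [a rva]; have m_neq0 : m%:Z != 0 by rewrite eqz_nat -lt0n.
exists `|(a %% m)%Z|%N.
  by rewrite /= -ltz_nat gez0_abs ?modz_ge0 // ltz_pmod.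
exists (v - s *~ a) => //; rewrite pmulrn gez0_abs ?modz_ge0 //.
suff -> : s *~ a = s *~ (a %% m)%Z by rewrite [LHS]addrC subrK.
rewrite {1}(divz_eq a m); move: (a %% m)%Z => k.
by rewrite mulrzDr mulrzA -pmulrn mV add0r.
Qed.

(** Some multiple of V is spanned by r.  A first element s of r with a multiple
    spanned by the rest can be dropped, at the cost of enlarging m; this cannot
    empty r, since then V would be a torsion group of bounded exponent generated
    by r0, hence finite.
    Once s is independent of the rest, the coefficient of s in v *+ m is well
    defined, and it is the value of the character at v.  Multiplying by m
    replaces the extension of a character from a subgroup of finite index. *)
Lemma int_span_character r0 r (m : nat) :
  infinite_set [set: V] -> (forall v, int_span r0 v) ->
  (0 < m)%N -> (forall v, int_span r (v *+ m)) ->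
  exists2 chi : V -> int, {morph chi : u v / u + v} & exists v, chi v != 0.
Proof.
move=> Vinf gen; elim: r m => [|s r IHr] m m_gt0 rm.
  case: Vinf; apply: sub_finite_set (int_span_torsion_finite r0 m_gt0 rm) => v _.
  exact: gen.
have [[n [n_gt0 rsn]]|s_free] := pselect (exists n, (0 < n)%N /\ int_span r (s *+ n)).
  apply: (IHr (m * n)%N) => [|v]; first by rewrite muln_gt0 m_gt0.
  have [a] := rm v => /(int_spanMn n) rva; rewrite mulrnA.
  rewrite -[_ *+ m](subrK (s *~ a)) mulrnDl; apply: int_spanD => //.
  case: a {rva} => k; rewrite ?NegzE ?mulrNz ?mulNrn; last apply: int_spanN.
    by rewrite -pmulrn mulrnAC; exact: int_spanMn.
  by rewrite -pmulrn mulrnAC; exact: int_spanMn.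
have s_free0 (a : int) : int_span r (s *~ a) -> a = 0.
  case: a => [[|k]|k] // rsk; case: s_free; exists k.+1; split=> //.
  by move/int_spanN: rsk; rewrite NegzE mulrNz opprK.
have /choice[chi chiP] : forall v, exists a : int, int_span r (v *+ m - s *~ a).
  exact: rm.
have chi_uniq v a : int_span r (v *+ m - s *~ a) -> chi v = a.
  move=> /(int_spanB (chiP v)); rewrite opprB addrC addrA subrK -mulrzBr.
  by move=> /s_free0/eqP; rewrite subr_eq0 => /eqP.
exists chi => [u v|].
  apply: chi_uniq; rewrite mulrnDl mulrzDr opprD addrACA.
  exact: int_spanD.
(* The coefficient of s in s *+ m is m itself. *)
exists s; rewrite (chi_uniq s m) ?eqz_nat -?lt0n // -pmulrn subrr.
exact: int_span0.
Qed.

End IntegerSpan.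

Section AdditiveCopy.
Context (G : groupType) (mulGC : forall x y : G, (x * y = y * x)%g).

(** The commutativity proof is a parameter of the alias so that the additive
    structure below can be inferred from the type alone. *)
Definition additive_copy : Type := let _ := mulGC in G.

HB.instance Definition _ := Choice.copy additive_copy G.

Fact additive_copyA : associative (fun x y : additive_copy => (x * y)%g).
Proof. exact: mulgA. Qed.
Fact additive_copyC : commutative (fun x y : additive_copy => (x * y)%g).
Proof. exact: mulGC. Qed.
Fact additive_copy0 :
  left_id (1%g : additive_copy) (fun x y : additive_copy => (x * y)%g).
Proof. exact: mul1g. Qed.
Fact additive_copyN : left_inverse (1%g : additive_copy)
  (fun x : additive_copy => x^-1%g) (fun x y : additive_copy => (x * y)%g).
Proof. exact: mulVg. Qed.

HB.instance Definition _ := GRing.isZmodule.Build additive_copy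
  additive_copyA additive_copyC additive_copy0 additive_copyN.

Lemma abelian_character :
  infinite_set [set: G] -> finitely_generated G ->
  exists2 chi : G -> int, (forall x y, chi (x * y)%g = chi x + chi y)
    & exists x, chi x != 0.
Proof.
move=> Ginf [S finS genS].
pose r : seq additive_copy := fset_set S.
have r_spans (v : additive_copy) : int_span r v.
  have : subgroup_generated S (v : G) by rewrite genS.
  apply: (@subgroup_generated_min _ _ [set x : G | int_span r (x : additive_copy)]).
    split=> [|x y]; rewrite !inE; first exact: (@int_span0 additive_copy).
    exact: (@int_spanB additive_copy).
  move=> x Sx; apply: (@int_span_mem additive_copy).
  by rewrite in_fset_set // inE.
by apply: (@int_span_character additive_copy r r 1) => // v; exact: r_spans.
Qed.

End AdditiveCopy.

(** * Gradings from orthogonal projections *)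

(** Applying p n to a decomposition into fixed vectors isolates its n-th term, so
    the family n |-> p n x is the only candidate; it is finitely supported
    because it vanishes outside any set N that resolves x. *)
Lemma projections_direct_sum (K : nzRingType) (V : lmodType K)
    (A : choiceType) (p : A -> {linear V -> V}) :
  (forall n m x, p n (p m x) = if n == m then p n x else 0) ->
  (forall x, exists N : {fset A}, x = \sum_(n <- N) p n x) ->
  forall x, exists! f : {fsfun A -> V with 0},
    (forall n, p n (f n) = f n) /\ x = \sum_(n <- finsupp f) f n.
Proof.
move=> pp pfin x; have [N xN] := pfin x.
have f_unique (f : {fsfun A -> V with 0}) :
    (forall n, p n (f n) = f n) -> x = \sum_(n <- finsupp f) f n ->
    forall n, f n = p n x.
  move=> pf -> n; rewrite linear_sum.
  have [nf|nf] := boolP (n \in finsupp f).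
    rewrite (big_fsetD1 n) //= pf big1_seq ?addr0 // => m /andP[_].
    by rewrite !inE => /andP[mn _]; rewrite -pf pp eq_sym (negbTE mn).
  rewrite fsfun_dflt // big1_seq // => m /andP[_ mf]; rewrite -pf pp.
  by case: eqP mf nf => // -> ->.
pose f : {fsfun A -> V with 0} := [fsfun n in N => p n x].
have fE n : f n = p n x.
  rewrite fsfunE; case: ifPn => // nN; rewrite {1}xN linear_sum big1_seq //.
  by move=> m /andP[_ mN]; rewrite pp; case: eqP mN nN => // -> ->.
exists f; split=> [|g [pg xg]]; last first.
  by apply/fsfunP => n; rewrite fE (f_unique g).
split=> [n|]; first by rewrite fE pp eqxx.
rewrite {1}xN; under [RHS]eq_bigr do rewrite fE.
apply/esym/big_fset_incl => [|n _ nf]; first exact: finsupp_sub.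
by rewrite -fE fsfun_dflt.
Qed.

(** * Linear maps and derivations on a group algebra *)

Section GroupAlgebraMaps.
Context {K : comNzRingType} {G : groupType}.
Local Notation KG := (group_algebra K G).
Implicit Types (a b : KG) (x y : G).

Definition ga_gen x : KG := << 1 *g x >>.

Lemma ga_genM x y : ga_gen (x * y)%g = ga_gen x * ga_gen y.
Proof. by rewrite -[RHS]/(ga_mul _ _) ga_mulUU mulr1. Qed.

Lemma ga_genE (k : K) x : << k *g x >> = k *: ga_gen x.
Proof. by apply/malgP => y; rewrite mcoeffZ !mcoeffU mulrnAr mulr1. Qed.

Lemma ga_gen_ind (P : KG -> Prop) :
  P 0 -> (forall a b, P a -> P b -> P (a + b)) ->
  (forall k a, P a -> P (k *: a)) -> (forall x, P (ga_gen x)) ->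
  forall a, P a.
Proof.
by move=> P0 PD PZ Pg; apply: ga_ind => // k x; rewrite ga_genE; exact: PZ.
Qed.

Lemma Der_ext (D E : Der KG) :
  (forall x, D (ga_gen x) = E (ga_gen x)) -> D = E.
Proof.
move=> DE; apply: DerP; apply: ga_gen_ind => // [|a b|k a].
- by rewrite !linear0.
- by rewrite !linearD /= => -> ->.
- by rewrite !linearZ /= => ->.
Qed.

(** By the Leibniz rule, the group elements killed by a derivation form a
    subgroup. *)
Lemma Der_eq0_gen (D : Der KG) (S : set G) :
  subgroup_generated S = [set: G] ->
  (forall x, S x -> D (ga_gen x) = 0) -> D = 0.
Proof.
move=> genS DS; have D1 : D (ga_gen 1%g) = 0.
  have := Der_leibniz D 1 1; rewrite !mulr1 mul1r => /eqP.
  by rewrite eq_sym -subr_eq0 addrK => /eqP.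
apply: Der_ext => x; have : subgroup_generated S x by rewrite genS.
apply: (@subgroup_generated_min _ _ [set x | D (ga_gen x) = 0]) => //.
split=> [|y z]; rewrite !inE //= => Dy Dz.
have: D (ga_gen (y / z * z)%g) * ga_gen z^-1%g = 0 by rewrite mulgVK Dy mul0r.
by rewrite ga_genM Der_leibniz Dz mulr0 addr0 -mulrA -ga_genM mulgV mulr1.
Qed.

Definition ga_lin (f : G -> KG) : KG -> KG := mmap (in_alg KG) f.

Lemma ga_lin_is_linear f : linear (ga_lin f).
Proof.
move=> k a b; rewrite [LHS]mmapD; congr (_ + _).
rewrite /ga_lin (mmapEw (msuppZ_le _ _)) mmapE scaler_sumr.
by apply: eq_bigr => x _; rewrite mcoeffZ /= -!scalerAl scalerA.
Qed.

HB.instance Definition _ f :=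
  GRing.isLinear.Build K KG KG _ (ga_lin f) (ga_lin_is_linear f).

Lemma ga_lin_gen f x : ga_lin f (ga_gen x) = f x.
Proof. by rewrite /ga_lin mmapU /= scale1r mul1r. Qed.

Lemma ga_lin_derivation f :
  (forall x y, f (x * y)%g = f x * ga_gen y + ga_gen x * f y) ->
  ga_lin f \in derivation.
Proof.
move=> fM; apply/asboolP; split; first exact: ga_lin_is_linear.
move=> a; elim/ga_gen_ind: a => [b|a a' IHa IHa' b|k a IHa b|x].
- by rewrite !(linear0, mul0r, addr0).
- by rewrite mulrDl !linearD /= IHa IHa' !mulrDl addrACA.
- by rewrite -!scalerAl !linearZ /= IHa scalerDr -!scalerAl.
elim/ga_gen_ind => [|b b' IHb IHb'|k b IHb|y].
- by rewrite !(linear0, mulr0, addr0).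
- by rewrite mulrDr !linearD /= IHb IHb' !mulrDr addrACA.
- by rewrite -!scalerAr !linearZ /= IHb scalerDr -!scalerAr.
by rewrite -ga_genM !ga_lin_gen fM.
Qed.

Definition gen_Der f
    (fM : forall x y, f (x * y)%g = f x * ga_gen y + ga_gen x * f y) : Der KG :=
  MkDer (ga_lin_derivation fM).

Lemma gen_DerE f fM x : @gen_Der f fM (ga_gen x) = f x.
Proof. exact: ga_lin_gen. Qed.

Lemma ad_derivation a : (fun b => a * b - b * a) \in derivation.
Proof.
apply/asboolP; split=> [k b c|b c].
  by rewrite mulrDl mulrDr -scalerAl -scalerAr scalerBr opprD addrACA.
by rewrite mulrBl mulrBr !mulrA addrA subrK.
Qed.

Definition ad a : Der KG := MkDer (ad_derivation a).

End GroupAlgebraMaps.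

(** * Homogeneous components of derivations *)

Section Components.
Context {K : comNzRingType} {G A : groupType}.
Context (AC : forall m n : A, (m * n = n * m)%g).
Context (phi : G -> A) (phiM : forall x y, phi (x * y)%g = (phi x * phi y)%g).
Local Notation KG := (group_algebra K G).
Implicit Types (a b : KG) (x y : G) (m n l : A) (D E : Der KG).

Definition ga_proj m : KG -> KG :=
  ga_lin (fun x => if phi x == m then ga_gen x else 0).

HB.instance Definition _ m := GRing.Linear.on (ga_proj m).

Lemma ga_proj_gen m x :
  ga_proj m (ga_gen x) = if phi x == m then ga_gen x else 0.
Proof. exact: ga_lin_gen. Qed.

Lemma ga_proj_proj m n a :
  ga_proj m (ga_proj n a) = if m == n then ga_proj m a else 0.
Proof.
move: a; apply: ga_gen_ind => [|a b IHa IHb|k a IHa|x]; last first.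
- rewrite !ga_proj_gen; case: eqP => [<-|xn]; rewrite ?ga_proj_gen ?linear0.
    by rewrite eq_sym; case: eqP.
  by case: eqP => // ->; case: eqP.
- by rewrite !linearZ /= IHa; case: eqP; rewrite ?scaler0.
- by rewrite !linearD /= IHa IHb; case: eqP; rewrite ?addr0.
by rewrite !linear0; case: eqP.
Qed.

Lemma mcoeff_proj m a x :
  (ga_proj m a)@_x = if phi x == m then a@_x else 0.
Proof.
move: a; apply: ga_gen_ind => [|a b IHa IHb|k a IHa|y].
- by rewrite linear0 mcoeff0 if_same.
- by rewrite linearD /= !mcoeffD IHa IHb; case: eqP; rewrite ?addr0.
- by rewrite linearZ /= !mcoeffZ IHa; case: eqP; rewrite ?mulr0.
rewrite ga_proj_gen; case: (eqVneq y x) => [->|yx].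
  by case: eqP; rewrite ?mcoeff0.
have gyx : (ga_gen y : KG)@_x = 0 by rewrite mcoeffU (negbTE yx).
by rewrite gyx if_same; case: ifP; rewrite ?mcoeff0.
Qed.

Lemma ga_projMr m a y :
  ga_proj (m * phi y)%g (a * ga_gen y) = ga_proj m a * ga_gen y.
Proof.
move: a; apply: ga_gen_ind => [|a b IHa IHb|k a IHa|x].
- by rewrite mul0r !linear0 mul0r.
- by rewrite mulrDl !linearD /= IHa IHb mulrDl.
- by rewrite -scalerAl !linearZ /= IHa -scalerAl.
rewrite -ga_genM !ga_proj_gen phiM (inj_eq (@mulIg _ _)).
by case: eqP => _; rewrite ?mul0r ?ga_genM.
Qed.

Lemma ga_projMl m a x :
  ga_proj (phi x * m)%g (ga_gen x * a) = ga_gen x * ga_proj m a.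
Proof.
move: a; apply: ga_gen_ind => [|a b IHa IHb|k a IHa|y].
- by rewrite mulr0 !linear0 mulr0.
- by rewrite mulrDr !linearD /= IHa IHb mulrDr.
- by rewrite -scalerAr !linearZ /= IHa -scalerAr.
rewrite -ga_genM !ga_proj_gen phiM (inj_eq (@mulgI _ _)).
by case: eqP => _; rewrite ?mulr0 ?ga_genM.
Qed.

(** The degrees occurring in an element are those of its finite support. *)
Lemma ga_proj_finite a : finite_set [set m | ga_proj m a <> 0].
Proof.
move: a; apply: ga_gen_ind => [|a b IHa IHb|k a IHa|x].
- by rewrite (_ : mkset _ = set0) // -subset0 => m /=; rewrite linear0.
- apply: (@sub_finite_set _ _ ([set m | ga_proj m a <> 0]
    `|` [set m | ga_proj m b <> 0])); last by rewrite finite_setU.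
  move=> m /=; rewrite linearD => ab0.
  have [a0|] := pselect (ga_proj m a = 0); last by left.
  by right=> b0; apply: ab0; rewrite /= a0 b0 addr0.
- apply: sub_finite_set IHa => m /=; rewrite linearZ => ka0 a0.
  by apply: ka0; rewrite /= a0 scaler0.
apply: (@sub_finite_set _ _ [set phi x]) => [m /=|]; last exact: finite_set1.
by rewrite ga_proj_gen; case: eqP => // ->.
Qed.

(** In the second term the degree n * phi x * phi y must be read as
    phi x * (n * phi y) to move x out: this is where A has to be abelian. *)
Fact component_gen_leibniz n (D : Der KG) x y :
  ga_proj (n * phi (x * y))%g (D (ga_gen (x * y)%g)) =
  ga_proj (n * phi x)%g (D (ga_gen x)) * ga_gen y
    + ga_gen x * ga_proj (n * phi y)%g (D (ga_gen y)).
Proof.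
rewrite ga_genM Der_leibniz linearD phiM /=; congr (_ + _).
  by rewrite mulgA ga_projMr.
by rewrite mulgA (AC n (phi x)) -mulgA ga_projMl.
Qed.

Definition component n (D : Der KG) : Der KG :=
  gen_Der (component_gen_leibniz n D).

Lemma component_gen n D x :
  component n D (ga_gen x) = ga_proj (n * phi x)%g (D (ga_gen x)).
Proof. exact: gen_DerE. Qed.

Lemma component_is_linear n : linear (component n).
Proof.
move=> k D E; apply: Der_ext => x; rewrite component_gen.
rewrite -[(k *: D + E) _]/(k *: D _ + E _).
rewrite -[RHS]/(k *: component n D _ + component n E _).
by rewrite !component_gen linearP.
Qed.

HB.instance Definition _ n := GRing.isLinear.Build K (Der KG) (Der KG) _
  (component n) (component_is_linear n).

Lemma component_component n m D :
  component n (component m D) = if n == m then component n D else 0.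
Proof.
apply: Der_ext => x; rewrite !component_gen ga_proj_proj.
rewrite (inj_eq (@mulIg _ _)); case: eqP => // _.
by rewrite component_gen.
Qed.

(** A nonzero component of D is nonzero on a generator s, so its degree is one of
    the finitely many degrees of D s, divided by phi s. *)
Lemma component_sum D : finitely_generated G ->
  exists N : {fset A}, D = \sum_(n <- N) component n D.
Proof.
move=> [S finS genS].
have finN : finite_set [set n | component n D <> 0].
  apply: (@sub_finite_set _ _
    (\bigcup_(s in S) [set n | ga_proj (n * phi s)%g (D (ga_gen s)) <> 0])).
    move=> n /= Dn; apply: contrapT => noS; apply: Dn.
    apply: Der_eq0_gen genS _ => x Sx; rewrite component_gen.
    by apply: contrapT => Dx; apply: noS; exists x.
  apply: bigcup_finite => // s _.
  apply: (@finite_preimage _ _ [set m | ga_proj m (D (ga_gen s)) <> 0]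
    (fun n => n * phi s)%g); last exact: ga_proj_finite.
  by move=> m n _ _; exact: mulIg.
exists (fset_set [set n | component n D <> 0]); set N := fset_set _.
have compN n : n \notin N -> component n D = 0.
  move=> nN; apply: contrapT => Dn; case/negP: nN.
  by rewrite in_fset_set // inE.
have sumE (s : seq A) a y :
    ((\sum_(n <- s) component n D) a)@_y = \sum_(n <- s) (component n D a)@_y.
  apply: (big_morph (fun E : Der KG => (E a)@_y)) => [E F|].
    exact: mcoeffD.
  exact: mcoeff0.
apply: Der_ext => x; apply/malgP => y; rewrite sumE.
under eq_bigr do rewrite component_gen mcoeff_proj.
(* The coefficient of y in D x belongs to the component of degree n0 only. *)
pose n0 := (phi y / phi x)%g.
have [n0N|n0N] := boolP (n0 \in N).
  rewrite (big_fsetD1 n0) //= mulgVK eqxx big1_seq ?addr0 // => n /andP[_].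
  rewrite !inE => /andP[nn0 _]; case: eqP => // yn.
  by rewrite /n0 yn mulgK eqxx in nn0.
rewrite big1_seq => [|n /andP[_ nN]].
  have : (component n0 D (ga_gen x))@_y = 0 by rewrite compN //; exact: mcoeff0.
  by rewrite component_gen mcoeff_proj mulgVK eqxx.
by case: eqP => // yn; rewrite /n0 yn mulgK nN in n0N.
Qed.

Definition graded_part n : {pred Der KG} := [pred D | component n D == D].

Lemma graded_partP n D : reflect
  (forall x, ga_proj (n * phi x)%g (D (ga_gen x)) = D (ga_gen x))
  (D \in graded_part n).
Proof.
apply: (iffP eqP) => [nD x|nD]; first by rewrite -{2}nD component_gen.
by apply: Der_ext => x; rewrite component_gen.
Qed.

(** A derivation of degree n shifts the degrees of all elements by n, not only
    those of group elements; degrees therefore add under composition. *)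
Lemma graded_part_proj n m D a :
  D \in graded_part n -> D (ga_proj m a) = ga_proj (n * m)%g (D a).
Proof.
move=> /graded_partP nD.
move: a; apply: ga_gen_ind => [|a b IHa IHb|k a IHa|x].
- by rewrite !linear0.
- by rewrite !linearD /= IHa IHb.
- by rewrite !linearZ /= IHa.
rewrite ga_proj_gen; case: eqP => [<-|xm]; first by rewrite nD.
rewrite linear0 -nD ga_proj_proj (inj_eq (@mulgI _ _)) eq_sym.
by case: eqP.
Qed.

Lemma graded_part_lie n l D E :
  D \in graded_part n -> E \in graded_part l ->
  lie D E \in graded_part (n * l)%g.
Proof.
move=> nD lE; apply/graded_partP => x.
have comp_deg m k (F H : Der KG) : F \in graded_part m -> H \in graded_part k ->
    ga_proj (m * k * phi x)%g (F (H (ga_gen x))) = F (H (ga_gen x)).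
  move=> mF /graded_partP kH.
  by rewrite -mulgA -(graded_part_proj _ _ mF) kH.
rewrite -[lie D E _]/(D (E (ga_gen x)) - E (D (ga_gen x))).
by rewrite linearB /= comp_deg // (AC n l) comp_deg.
Qed.

Lemma ad_gen_graded g : ad (ga_gen g) \in graded_part (phi g).
Proof.
apply/graded_partP => x.
by rewrite /= -!ga_genM linearB /= !ga_proj_gen !phiM (AC (phi x)) eqxx.
Qed.

Lemma graded_part_submod n : GRing.submod_closed (graded_part n).
Proof.
split=> [|k D E /eqP nD /eqP nE]; apply/eqP; first exact: linear0.
by rewrite linearP; congr (k *: _ + _).
Qed.

Lemma graded_part_disjoint n m D :
  D \in graded_part n -> D \in graded_part m -> D <> 0 -> n = m.
Proof.
move=> /eqP nD /eqP mD D0; apply/eqP; apply: contra_notT D0 => nm.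
by rewrite -nD -mD component_component (negbTE nm).
Qed.

Lemma graded_part_grading :
  finitely_generated G ->
  (exists n D, [/\ n <> 1%g, D \in graded_part n & D <> 0]) ->
  is_grading graded_part.
Proof.
move=> fgG [n0 [D0 [n0_neq1 n0D0 D0_neq0]]]; split.
- exact: graded_part_submod.
- move=> D; have [f [[pf Df] f_uniq]] := @projections_direct_sum K (Der KG) A
    component component_component (fun E => component_sum E fgG) D.
  exists f; split=> [|g [pg Dg]]; first by split=> // n; apply/eqP; exact: pf.
  by apply: f_uniq; split=> // n; apply/eqP; exact: pg.
- exact: graded_part_lie.
move=> D1; apply: n0_neq1; apply: graded_part_disjoint n0D0 _ D0_neq0.
by rewrite D1.
Qed.

End Components.

(** * A derivation of nontrivial degree *)

Section Nontrivial.
Context {K : numDomainType} {G A : groupType}.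
Context (AC : forall m n : A, (m * n = n * m)%g).
Context (phi : G -> A) (phiM : forall x y, phi (x * y)%g = (phi x * phi y)%g).
Local Notation KG := (group_algebra K G).

(** The inner derivation by g sends h to g * h - h * g. *)
Lemma noncentral_part g h : (g * h <> h * g)%g ->
  exists2 D : Der KG, D \in graded_part AC phiM (phi g) & D <> 0.
Proof.
move=> gh; exists (ad (ga_gen g)); first exact: ad_gen_graded.
move=> /(congr1 (fun D : Der KG => (D (ga_gen h))@_(g * h)%g)) /eqP.
rewrite /= -!ga_genM mcoeffB mcoeff0 !mcoeffU eqxx.
have /negbTE-> : (h * g)%g != (g * h)%g by apply/eqP => /esym.
by rewrite subr0 oner_eq0.
Qed.

(** The map x |-> chi x * x extends to a derivation of degree 1; as g is central,
    its product with g is again a derivation, now of degree phi g. *)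
Lemma character_part (chi : G -> int) (g : G) :
  (forall x y : G, (x * y = y * x)%g) ->
  {morph chi : x y / (x * y)%g >-> x + y} -> (exists x, chi x != 0) ->
  exists2 D : Der KG, D \in graded_part AC phiM (phi g) & D <> 0.
Proof.
move=> GC chiM [x0 chi0].
pose f x : KG := (chi x)%:~R *: ga_gen (x * g)%g.
have fM x y : f (x * y)%g = f x * ga_gen y + ga_gen x * f y.
  rewrite /f chiM intrD scalerDl -scalerAl -scalerAr -!ga_genM -!mulgA.
  by rewrite (GC g y).
exists (gen_Der fM).
  apply/graded_partP => x.
  by rewrite gen_DerE linearZ /= ga_proj_gen phiM (AC (phi x)) eqxx.
move=> /(congr1 (fun D : Der KG => (D (ga_gen x0))@_(x0 * g)%g)) /eqP.
by rewrite /= ga_lin_gen mcoeffZ mcoeffU eqxx mulr1 mcoeff0 intr_eq0 (negbTE chi0).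
Qed.

Lemma Der_graded_with :
  infinite_set [set: G] -> finitely_generated G ->
  (exists g, phi g <> 1%g) -> graded_with A (Der KG).
Proof.
move=> Ginf fgG [g0 g0_neq1]; split=> //; exists (graded_part AC phiM).
apply: graded_part_grading => //.
have [[g [h [g_neq1 gh]]]|central] :=
    pselect (exists g h, phi g <> 1%g /\ (g * h <> h * g)%g).
  by have [D gD D0] := noncentral_part gh; exists (phi g), D.
have cent g h : phi g <> 1%g -> (g * h = h * g)%g.
  by move=> g1; apply: contrapT => gh; apply: central; exists g, h.
(* An x in the kernel of phi is the quotient of g0 * x by g0, which are both
   outside the kernel and hence central. *)
have GC (x y : G) : (x * y = y * x)%g.
  have [x1|] := pselect (phi x = 1%g); last exact: cent.
  have g0xy : (g0 * x * y = y * (g0 * x))%g.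
    by apply: cent; rewrite phiM x1 mulg1.
  by apply: (@mulgI _ g0); rewrite !mulgA g0xy (cent g0 y) // mulgA.
have [chi chiM chi0] := abelian_character GC Ginf fgG.
have [D gD D0] := character_part g0 GC chiM chi0.
by exists (phi g0), D.
Qed.

End Nontrivial.

Theorem corollary2 (R : realType) (G : groupType)
    (G_infinite : infinite_set [set: G])
    (G_fin_gen : finitely_generated G)
    (G_not_perfect : commutator_subgroup G <> [set: G]) :
  graded_with (abelianization G) (Der (group_algebra R[i] G)).
Proof.
have [g Gg] : exists g, ~ commutator_subgroup G g.
  apply: contrapT => noG; apply: G_not_perfect; rewrite -subTset => g _.
  by apply: contrapT => Gg; apply: noG; exists g.
apply: (@Der_graded_with _ _ _ abelianizationC
  (\pi_(abelianization G))%qT ab_piM) => //.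
exists g => /esym/ab_eqP; rewrite invg1 mul1g; exact: Gg.
Qed.
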